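(* There are group isomorphisms with respect to multiplication $$(CM_2^*,\cdot)\cong(LC_2^*,\cdot),\qquad (CM_2^1,\cdot)\cong(\mathcal{U},\cdot),\qquad (CM_2^+,\cdot)\cong(\mathcal{H},\cdot),\qquad (CM_2^{++},\cdot)\cong(\mathcal{E},\cdot).$$
   Context: $\mathbb{P}_2$ is the real vector space of all functions $f:\mathbb{R}\to\mathbb{R}$ with $f(t+2)=f(t)$ for all $t$. $I$ is the identity operator and $E$ the unit shift $(Ef)(t)=f(t+1)$ on $\mathbb{P}_2$, so $E^2=I$. $LC_2=\{xI+yE: x,y\in\mathbb{R}\}$, with multiplication $(x_1I+y_1E)(x_2I+y_2E)=(x_1x_2+y_1y_2)I+(x_1y_2+x_2y_1)E$. Subsets of $LC_2$: $LC_2^*=\{xI+yE: x^2-y^2\neq0\}$, $\mathcal{H}=\{xI+yE: x^2-y^2>0\}$, $\mathcal{U}=\{xI+yE: x^2-y^2=1\}$, $\mathcal{E}=\{xI+yE\in\mathcal{H}: x>0\}$; each is a group under multiplication. $CM_2$ is the set of real matrices $C=\begin{pmatrix}a&b\\ b&a\end{pmatrix}$, $a,b\in\mathbb{R}$, with matrix multiplication, and $CM_2^*=\{C\in CM_2:\det C\neq0\}$, $CM_2^+=\{C\in CM_2:\det C>0\}$, $CM_2^{++}=\{C\in CM_2^+: a>0\}$, $CM_2^1=\{C\in CM_2:\det C=1\}$; each is a group under matrix multiplication. *)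

(* Defs.v *)
From HB Require Import structures.
From mathcomp Require Import all_boot all_order all_algebra.
From mathcomp Require Import ring lra zify.
From mathcomp Require Import mathcomp_extra boolp classical_sets functions reals.
From mathcomp Require Import trigo.

Set Implicit Arguments.
Unset Strict Implicit.
Unset Printing Implicit Defensive.
Import Order.TTheory GRing.Theory Num.Theory.
Local Open Scope classical_set_scope.
Local Open Scope ring_scope.

(* group_on turns a subset A of M that is a group under op, with identity e,
   into a groupType carried by {x : M | x \in A}; its product is op. *)
Section Groups.
Context {M : choiceType}.

Record is_group (op : M -> M -> M) (e : M) (A : set M) : Prop := IsGroup {
  group_closed_op : forall x y, A x -> A y -> A (op x y);
  group_assoc : forall x y z, A x -> A y -> A z ->
    op x (op y z) = op (op x y) z;
  group_one : A e;
  group_left_id : forall x, A x -> op e x = x;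
  group_right_id : forall x, A x -> op x e = x;
  group_inverse : forall x, A x ->
    exists y, [/\ A y, op y x = e & op x y = e]
}.

Variables (op : M -> M -> M) (e : M) (A : set M) (gA : is_group op e A).

Local Notation T := {x : M | x \in A}.

Let Tin (x : T) : A (val x). Proof. exact: set_mem (valP x). Qed.

Definition group_on_mul (x y : T) : T :=
  exist _ (op (val x) (val y)) (mem_set (group_closed_op gA (Tin x) (Tin y))).

Definition group_on_one : T := exist _ e (mem_set (group_one gA)).

Let inv_ex (x : T) :
  exists y : T, group_on_mul y x = group_on_one /\
                group_on_mul x y = group_on_one.
Proof.
have [y [Ay yx xy]] := group_inverse gA (Tin x).
by exists (exist _ y (mem_set Ay)); split; apply: val_inj.
Qed.

Definition group_on_inv (x : T) : T := projT1 (cid (inv_ex x)).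

Lemma group_on_mulA : associative group_on_mul.
Proof. by move=> x y z; apply: val_inj; apply: (group_assoc gA); apply: Tin. Qed.

Lemma group_on_1mul : left_id group_on_one group_on_mul.
Proof. by move=> x; apply: val_inj; apply: (group_left_id gA); apply: Tin. Qed.

Lemma group_on_mul1 : right_id group_on_one group_on_mul.
Proof. by move=> x; apply: val_inj; apply: (group_right_id gA); apply: Tin. Qed.

Lemma group_on_Vmul : left_inverse group_on_one group_on_inv group_on_mul.
Proof. by move=> x; rewrite /group_on_inv; case: cid => y []. Qed.

Lemma group_on_mulV : right_inverse group_on_one group_on_inv group_on_mul.
Proof. by move=> x; rewrite /group_on_inv; case: cid => y []. Qed.

Definition group_on : groupType :=
  HB.pack T (isGroup.Build T group_on_mulA group_on_1mul group_on_mul1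
               group_on_Vmul group_on_mulV).

End Groups.

Definition group_isomorphic (G H : groupType) : Prop :=
  exists f : {multiplicative G -> H}, bijective f.

Definition periodic2 (R : realType) : set (R -> R) := [set f | periodic f 2].
Arguments periodic2 : clear implicits.

(* R^o is R seen as a vector space over itself, so that R -> R^o carries the
   pointwise vector space structure. *)
Lemma periodic2_submod_closed (R : realType) :
  submod_closed (mem (periodic2 R) : {pred R -> R^o}).
Proof.
split; first by rewrite inE => t.
move=> a f g /set_mem pf /set_mem pg; apply/mem_set => t.
by have := pf t; have := pg t; rewrite /= !addrfctE !scalrfctE => -> ->.
Qed.

Record P2 (R : realType) := MkP2 {
  P2fun :> R -> R;
  _ : P2fun \in periodic2 R
}.

HB.instance Definition _ (R : realType) := [isSub for @P2fun R].
HB.instance Definition _ (R : realType) := [Choice of P2 R by <:].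
HB.instance Definition _ (R : realType) :=
  GRing.SubChoice_isSubLmodule.Build R (R -> R^o) _ (P2 R)
    (periodic2_submod_closed R).

Lemma shift_subproof (R : realType) (f : P2 R) :
  (fun t : R => f (t + 1)) \in periodic2 R.
Proof.
by apply/mem_set => t; rewrite addrAC; apply: (set_mem (valP f)).
Qed.

Definition idop (R : realType) : P2 R -> P2 R := idfun.

Definition shift (R : realType) : P2 R -> P2 R :=
  fun f => MkP2 (shift_subproof f).

Definition compop (R : realType) (S T : P2 R -> P2 R) : P2 R -> P2 R := S \o T.

Lemma shift_is_linear (R : realType) : linear (@shift R).
Proof. by move=> a f g; apply: val_inj. Qed.

HB.instance Definition _ (R : realType) :=
  GRing.isLinear.Build R (P2 R) (P2 R) _ (@shift R) (@shift_is_linear R).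

Lemma shiftK (R : realType) : compop (@shift R) (@shift R) = @idop R.
Proof.
apply/funext => f; apply: val_inj; apply/funext => t /=.
by rewrite -addrA; apply: (set_mem (valP f)).
Qed.

Definition lc (R : realType) (x y : R) : P2 R -> P2 R :=
  x *: @idop R + y *: @shift R.

Lemma lcE (R : realType) (x y : R) (f : P2 R) (t : R) :
  lc x y f t = x * f t + y * f (t + 1).
Proof. by []. Qed.

(* The multiplication is the composition of operators; in coordinates it is
   given by the formula of lc_comp, and the coordinates are unique (lc_inj). *)
Lemma lc_comp (R : realType) (x1 y1 x2 y2 : R) :
  compop (lc x1 y1) (lc x2 y2) = lc (x1 * x2 + y1 * y2) (x1 * y2 + x2 * y1).
Proof.
apply/funext => f; apply: val_inj; apply/funext => t.
rewrite [LHS](lcE x1 y1 (lc x2 y2 f) t) [RHS]lcE !lcE -addrA.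
have -> : f (t + (1 + 1)) = f t by apply: (set_mem (valP f)).
by ring.
Qed.

Lemma lc10 (R : realType) : lc 1 0 = @idop R.
Proof. by rewrite /lc scale1r scale0r addr0. Qed.

Lemma parity_wave_subproof (R : realType) :
  (fun t : R => if (t / 2 \is a Num.int) then 1 else 0 : R) \in periodic2 R.
Proof.
apply/mem_set => t /=; rewrite mulrDl divff ?pnatr_eq0//.
by rewrite rpredDr ?rpred1.
Qed.

Lemma lc_inj (R : realType) (x1 y1 x2 y2 : R) :
  lc x1 y1 = lc x2 y2 -> x1 = x2 /\ y1 = y2.
Proof.
pose w := MkP2 (parity_wave_subproof R).
have w0 : w 0 = 1 by rewrite /w /= mul0r rpred0.
have w1 : w 1 = 0.
  rewrite /w /= mul1r; case: ifPn => // /intrP[m] h.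
  have /eqP : (m * 2)%:~R = 1%:~R :> R by rewrite intrM -h mulVf// pnatr_eq0.
  by rewrite eqr_int => /eqP; lia.
have w2 : w (1 + 1) = 1 by rewrite /w /= (divff (_ : 2 != 0)) ?pnatr_eq0// rpred1.
move=> e12; split.
  by have := lcE x1 y1 w 0; rewrite e12 lcE add0r w0 w1 !mulr1 !mulr0 !addr0.
by have := lcE x1 y1 w 1; rewrite e12 lcE w1 w2 !mulr1 !mulr0 !add0r.
Qed.

Definition LC2 (R : realType) : set (P2 R -> P2 R) :=
  [set T | exists x y : R, T = lc x y].

Definition LC2_star (R : realType) : set (P2 R -> P2 R) :=
  [set T | exists x y : R, T = lc x y /\ x ^+ 2 - y ^+ 2 != 0].

Definition LC2_H (R : realType) : set (P2 R -> P2 R) :=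
  [set T | exists x y : R, T = lc x y /\ 0 < x ^+ 2 - y ^+ 2].

Definition LC2_U (R : realType) : set (P2 R -> P2 R) :=
  [set T | exists x y : R, T = lc x y /\ x ^+ 2 - y ^+ 2 = 1].

Definition LC2_E (R : realType) : set (P2 R -> P2 R) :=
  [set T | exists x y : R, [/\ T = lc x y, LC2_H T & 0 < x]].

Definition circ2 (R : realType) (a b : R) : 'M[R]_2 :=
  \matrix_(i, j) if i == j then a else b.

Definition CM2 (R : realType) : set 'M[R]_2 :=
  [set C | exists a b : R, C = circ2 a b].

Definition CM2_star (R : realType) : set 'M[R]_2 :=
  [set C | CM2 C /\ \det C != 0].

Definition CM2_plus (R : realType) : set 'M[R]_2 :=
  [set C | CM2 C /\ 0 < \det C].

Definition CM2_plusplus (R : realType) : set 'M[R]_2 :=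
  [set C | exists a b : R, [/\ C = circ2 a b, CM2_plus C & 0 < a]].

Definition CM2_one (R : realType) : set 'M[R]_2 :=
  [set C | CM2 C /\ \det C = 1].

Lemma circ2_mul (R : realType) (a1 b1 a2 b2 : R) :
  circ2 a1 b1 *m circ2 a2 b2 = circ2 (a1 * a2 + b1 * b2) (a1 * b2 + a2 * b1).
Proof.
apply/matrixP => i j; rewrite !mxE !big_ord_recl big_ord0 !mxE addr0.
by case: i => [[|[|//]]] ?; case: j => [[|[|//]]] ? /=; ring.
Qed.

Lemma circ2_10 (R : realType) : circ2 1 0 = 1%:M :> 'M[R]_2.
Proof. by apply/matrixP => i j; rewrite !mxE; case: (i == j). Qed.

Lemma det_circ2 (R : realType) (a b : R) :
  \det (circ2 a b) = a ^+ 2 - b ^+ 2.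
Proof.
rewrite (expand_det_row _ ord0) !big_ord_recl big_ord0 /cofactor !det_mx11.
by rewrite !mxE /=; ring.
Qed.

Section CoordinateGroups.
Variable R : realType.

(* Both LC2 and CM2 are parametrized by pairs (x, y) that multiply as the
   split-complex numbers, so their subgroups are handled together. *)
Let Q_group (Q : R -> R -> Prop) :=
  [/\ Q 1 0,
      forall x1 y1 x2 y2, Q x1 y1 -> Q x2 y2 ->
        Q (x1 * x2 + y1 * y2) (x1 * y2 + x2 * y1)
    & forall x y, Q x y -> x ^+ 2 - y ^+ 2 != 0 /\
        Q (x / (x ^+ 2 - y ^+ 2)) (- y / (x ^+ 2 - y ^+ 2))].

Let is_group_pairs (M : choiceType) (op : M -> M -> M) (e : M)
    (phi : R -> R -> M) (Q : R -> R -> Prop) (A : set M) :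
  (forall x1 y1 x2 y2, op (phi x1 y1) (phi x2 y2) =
     phi (x1 * x2 + y1 * y2) (x1 * y2 + x2 * y1)) ->
  phi 1 0 = e -> Q_group Q ->
  (forall T, A T <-> exists x y, T = phi x y /\ Q x y) ->
  is_group op e A.
Proof.
move=> opE <- [Q1 QM QV] AE; split.
- move=> _ _ /AE[x1 [y1 [-> h1]]] /AE[x2 [y2 [-> h2]]]; apply/AE.
  by rewrite opE; do 2 eexists; split; [reflexivity|exact: QM].
- move=> _ _ _ /AE[x1 [y1 [-> _]]] /AE[x2 [y2 [-> _]]] /AE[x3 [y3 [-> _]]].
  by rewrite !opE; congr phi; ring.
- by apply/AE; exists 1, 0.
- by move=> _ /AE[x [y [-> _]]]; rewrite opE; congr phi; ring.
- by move=> _ /AE[x [y [-> _]]]; rewrite opE; congr phi; ring.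
- move=> _ /AE[x [y [-> Qxy]]]; have [d0 QVxy] := QV _ _ Qxy.
  exists (phi (x / (x ^+ 2 - y ^+ 2)) (- y / (x ^+ 2 - y ^+ 2))).
  split; first by apply/AE; do 2 eexists; split; [reflexivity|].
  + by rewrite opE; congr phi; field.
  + by rewrite opE; congr phi; field.
Qed.

Let hypM (x1 y1 x2 y2 : R) :
  (x1 * x2 + y1 * y2) ^+ 2 - (x1 * y2 + x2 * y1) ^+ 2 =
  (x1 ^+ 2 - y1 ^+ 2) * (x2 ^+ 2 - y2 ^+ 2).
Proof. by ring. Qed.

Let hyp10 : 1 ^+ 2 - 0 ^+ 2 = 1 :> R.
Proof. by ring. Qed.

Let hypV (x y : R) (d := x ^+ 2 - y ^+ 2) : d != 0 ->
  (x / d) ^+ 2 - (- y / d) ^+ 2 = d^-1.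
Proof. by rewrite /d => d0; field. Qed.

Let Q_star : Q_group (fun x y => x ^+ 2 - y ^+ 2 != 0).
Proof.
split=> [|x1 y1 x2 y2 h1 h2|x y h]; first by rewrite hyp10 oner_eq0.
- by rewrite hypM mulf_neq0.
- by rewrite hypV// invr_eq0.
Qed.

Let Q_pos : Q_group (fun x y => 0 < x ^+ 2 - y ^+ 2).
Proof.
split=> [|x1 y1 x2 y2 h1 h2|x y h]; first by rewrite hyp10 ltr01.
- by rewrite hypM mulr_gt0.
- by have d0 := lt0r_neq0 h; rewrite hypV// invr_gt0.
Qed.

Let Q_one : Q_group (fun x y => x ^+ 2 - y ^+ 2 = 1).
Proof.
split=> [|x1 y1 x2 y2 h1 h2|x y h]; first exact: hyp10.
- by rewrite hypM h1 h2 mulr1.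
- have d0 : x ^+ 2 - y ^+ 2 != 0 by rewrite h oner_eq0.
  by split=> //; rewrite hypV// h invr1.
Qed.

Let Q_pospos : Q_group (fun x y => 0 < x ^+ 2 - y ^+ 2 /\ 0 < x).
Proof.
split=> [|x1 y1 x2 y2 [h1 p1] [h2 p2]|x y [h p]].
- by rewrite hyp10 ltr01.
- rewrite hypM mulr_gt0//; split=> //.
  have /andP[? ?] : - x1 < y1 < x1 by apply/andP; split; nra.
  have /andP[? ?] : - x2 < y2 < x2 by apply/andP; split; nra.
  by nra.
- by have d0 := lt0r_neq0 h; rewrite hypV// invr_gt0 divr_gt0.
Qed.

Lemma LC2_star_group : is_group (@compop R) (@idop R) (@LC2_star R).
Proof. exact: (is_group_pairs (@lc_comp R) (@lc10 R) Q_star). Qed.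

Lemma LC2_U_group : is_group (@compop R) (@idop R) (@LC2_U R).
Proof. exact: (is_group_pairs (@lc_comp R) (@lc10 R) Q_one). Qed.

Lemma LC2_H_group : is_group (@compop R) (@idop R) (@LC2_H R).
Proof. exact: (is_group_pairs (@lc_comp R) (@lc10 R) Q_pos). Qed.

Lemma LC2_E_group : is_group (@compop R) (@idop R) (@LC2_E R).
Proof.
apply: (is_group_pairs (@lc_comp R) (@lc10 R) Q_pospos) => T.
split=> [[x [y [-> [x' [y' [/lc_inj[-> ->] h]]] p]]]|[x [y [-> [h p]]]]].
  by exists x', y'; split=> //; split=> //; lra.
by exists x, y; split=> //; exists x, y.
Qed.

Lemma CM2_star_group : is_group mulmx 1%:M (@CM2_star R).
Proof.
apply: (is_group_pairs (@circ2_mul R) (@circ2_10 R) Q_star) => C; split.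
  by move=> [[a [b ->]]]; rewrite det_circ2 => h; exists a, b.
by move=> [a [b [-> h]]]; split; [exists a, b|rewrite det_circ2].
Qed.

Lemma CM2_plus_group : is_group mulmx 1%:M (@CM2_plus R).
Proof.
apply: (is_group_pairs (@circ2_mul R) (@circ2_10 R) Q_pos) => C; split.
  by move=> [[a [b ->]]]; rewrite det_circ2 => h; exists a, b.
by move=> [a [b [-> h]]]; split; [exists a, b|rewrite det_circ2].
Qed.

Lemma CM2_one_group : is_group mulmx 1%:M (@CM2_one R).
Proof.
apply: (is_group_pairs (@circ2_mul R) (@circ2_10 R) Q_one) => C; split.
  by move=> [[a [b ->]]]; rewrite det_circ2 => h; exists a, b.
by move=> [a [b [-> h]]]; split; [exists a, b|rewrite det_circ2].
Qed.

Lemma CM2_plusplus_group : is_group mulmx 1%:M (@CM2_plusplus R).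
Proof.
apply: (is_group_pairs (@circ2_mul R) (@circ2_10 R) Q_pospos) => C; split.
  by move=> [a [b [-> [_]]]]; rewrite det_circ2 => h p; exists a, b.
move=> [a [b [-> [h p]]]]; exists a, b; split=> //.
by split; [exists a, b|rewrite det_circ2].
Qed.

End CoordinateGroups.

(* Main.v *)
Require Import Defs.
From HB Require Import structures.
From mathcomp Require Import all_boot all_order all_algebra reals.
From mathcomp Require Import boolp classical_sets functions.

(** The circulant matrix [circ2 a b] and the operator [lc a b] are two
    faithful realizations of one coordinate pair [(a, b)]: both families
    multiply like the split-complex numbers ([circ2_mul], [lc_comp]) and both
    determine their coordinates, the matrix because they are its entries, the
    operator by [lc_inj].  Hence reading the coordinates off the first row of
    a matrix carries [circ2 a b] to [lc a b] and respects products.  As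
    [\det (circ2 a b) = a ^+ 2 - b ^+ 2], each of the four subgroups of
    matrices is cut out by the same condition on [(a, b)] as the corresponding
    subgroup of operators, so that this single map restricts to the four
    isomorphisms ([group_isomorphic_coords]). *)

Set Implicit Arguments.
Unset Strict Implicit.
Unset Printing Implicit Defensive.

Local Open Scope classical_set_scope.
Local Open Scope ring_scope.

(** Isomorphisms of the bundled groups [group_on] can thus be given by plain
    functions on the ambient types, without handling the subtypes. *)
Lemma group_isomorphic_set_bij (M N : choiceType)
    (op : M -> M -> M) (e : M) (A : set M) (gA : is_group op e A)
    (op' : N -> N -> N) (e' : N) (B : set N) (gB : is_group op' e' B)
    (f : M -> N) :
  set_bij A B f ->
  (forall x y, A x -> A y -> f (op x y) = op' (f x) (f y)) ->
  group_isomorphic (group_on gA) (group_on gB).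
Proof.
move=> [fAB f_inj f_surj] fM.
have inA (x : {x : M | x \in A}) : A (val x) by exact: set_mem (valP x).
pose F (x : group_on gA) : group_on gB :=
  exist _ (f (val x)) (mem_set (fAB _ (inA x))).
have FM : {morph F : x y / (x * y)%g >-> (x * y)%g}.
  by move=> x y; apply: val_inj; apply: fM; apply: inA.
pose FMm := isMultiplicative.Build (group_on gA) (group_on gB) F FM.
pose Fm : {multiplicative group_on gA -> group_on gB} := HB.pack F FMm.
exists Fm.
have F_surj (y : group_on gB) : exists x, F x = y.
  have [x Ax fx] := f_surj _ (set_mem (valP y)).
  by exists (exist _ x (mem_set Ax)); apply: val_inj.
have F_inj : injective F.
  move=> x1 x2 /(congr1 val) /= eqf; apply: val_inj.
  by apply: f_inj => //; apply/mem_set; apply: inA.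
pose G y := projT1 (cid (F_surj y)).
have GK : cancel G F by move=> y; exact: projT2 (cid (F_surj y)).
by exists G => // x; apply: F_inj; rewrite GK.
Qed.

Section CirculantOperators.
Variable R : realType.

Definition lc_of_circ (C : 'M[R]_2) : P2 R -> P2 R := lc (C 0 0) (C 0 1).

Lemma lc_of_circ2 (a b : R) : lc_of_circ (circ2 a b) = lc a b.
Proof. by rewrite /lc_of_circ !mxE. Qed.

(** [lc_of_circ] only needs a common description of both sides: the same
    coordinate condition [Q] must carve out the matrices and the operators. *)
Lemma group_isomorphic_coords (Q : R -> R -> Prop)
    (A : set 'M[R]_2) (gA : is_group mulmx 1%:M A)
    (B : set (P2 R -> P2 R)) (gB : is_group (@compop R) (@idop R) B) :
  (forall C, A C <-> exists a b, C = circ2 a b /\ Q a b) ->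
  (forall T, B T <-> exists a b, T = lc a b /\ Q a b) ->
  group_isomorphic (group_on gA) (group_on gB).
Proof.
move=> AE BE; have lc_bij : set_bij A B lc_of_circ.
  split.
  - by move=> _ /AE[a [b [-> Qab]]]; apply/BE; exists a, b; rewrite lc_of_circ2.
  - move=> _ _ /set_mem/AE[a [b [-> _]]] /set_mem/AE[c [d [-> _]]].
    by rewrite !lc_of_circ2 => /lc_inj[-> ->].
  - move=> _ /BE[a [b [-> Qab]]]; exists (circ2 a b); last exact: lc_of_circ2.
    by apply/AE; exists a, b.
apply: (group_isomorphic_set_bij _ _ lc_bij).
move=> _ _ /AE[a [b [-> _]]] /AE[c [d [-> _]]].
by rewrite circ2_mul !lc_of_circ2 lc_comp.
Qed.

Lemma CM2_detP (P : R -> Prop) (C : 'M[R]_2) :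
  CM2 C /\ P (\det C) <-> exists a b, C = circ2 a b /\ P (a ^+ 2 - b ^+ 2).
Proof.
split=> [[[a [b ->]]]|[a [b [-> Pab]]]].
  by rewrite det_circ2 => Pab; exists a, b.
by rewrite det_circ2; split=> //; exists a, b.
Qed.

Lemma CM2_plusplusP (C : 'M[R]_2) :
  CM2_plusplus C <->
  exists a b, C = circ2 a b /\ (0 < a ^+ 2 - b ^+ 2 /\ 0 < a).
Proof.
split=> [[a [b [-> [_ +] a0]]]|[a [b [-> [ab a0]]]]].
  by rewrite det_circ2 => ab; exists a, b.
by exists a, b; split=> //; split; [exists a, b|rewrite det_circ2].
Qed.

Lemma LC2_EP (T : P2 R -> P2 R) :
  LC2_E T <-> exists a b, T = lc a b /\ (0 < a ^+ 2 - b ^+ 2 /\ 0 < a).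
Proof.
split=> [[x [y [-> [a [b [/lc_inj[-> ->] ab]]] a0]]]|[a [b [-> [ab a0]]]]].
  by exists a, b.
by exists a, b; split=> //; exists a, b.
Qed.

End CirculantOperators.

Theorem theorem2p42 (R : realType) :
  [/\ group_isomorphic (group_on (CM2_star_group R))
                       (group_on (LC2_star_group R)),
      group_isomorphic (group_on (CM2_one_group R))
                       (group_on (LC2_U_group R)),
      group_isomorphic (group_on (CM2_plus_group R))
                       (group_on (LC2_H_group R))
    & group_isomorphic (group_on (CM2_plusplus_group R))
                       (group_on (LC2_E_group R))].
Proof.
split.
- apply: (group_isomorphic_coords _ _ (CM2_detP (fun d => d != 0))).
  by move=> T; exact: iff_refl.
- apply: (group_isomorphic_coords _ _ (CM2_detP (fun d => d = 1))).
  by move=> T; exact: iff_refl.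
- apply: (group_isomorphic_coords _ _ (CM2_detP (fun d => 0 < d))).
  by move=> T; exact: iff_refl.
- exact: (group_isomorphic_coords _ _ (@CM2_plusplusP R) (@LC2_EP R)).
Qed.
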